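(* Let $p<q$ be primes with $p$ odd, let $n=q^2$, and consider the finite non-abelian group $T_{4n}\times C_p$ of order $4q^2p$. Let $t$ be the integer such that the number of cyclic subgroups of $T_{4n}\times C_p$ equals $|T_{4n}\times C_p|-t$. Then $t=2q^2(2p-1)-12$; that is, the number of cyclic subgroups of $T_{4q^2}\times C_p$ is $$4q^2p-\bigl(2q^2(2p-1)-12\bigr).$$
   Context: $T_{4n}$ denotes the dicyclic group of order $4n$, $T_{4n}=\langle \alpha,\beta \mid \alpha^{2n}=e,\ \alpha^n=\beta^2,\ \beta\alpha\beta^{-1}=\alpha^{-1}\rangle$. $C_p$ is the cyclic group of order $p$. The trivial subgroup is counted as cyclic. *)

(* Defs.v *)
From mathcomp Require Import all_boot all_order all_algebra all_fingroup all_solvable.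

Set Implicit Arguments.
Unset Strict Implicit.
Unset Printing Implicit Defensive.

Local Open Scope group_scope.

(* [\isog Grp] denotes the largest finite quotient of the presented group; the
   presented group is finite here (of order 4n for n > 0), so it is that group.
   Conjugation is spelled out because [x ^ y] means [y^-1 * x * y]. *)
Definition dicyclic (gT : finGroupType) (T : {group gT}) (n : nat) : Prop :=
  T \isog Grp (alpha : beta :
    alpha ^+ (2 * n)%N = 1, alpha ^+ n = beta ^+ 2,
    beta * alpha * beta^-1 = alpha^-1).

Definition cyclic_subgroups (gT : finGroupType) (G : {group gT}) :
    {set {group gT}} :=
  [set H : {group gT} | (H \subset G) && cyclic H].

(* Main.v *)
(* As [T] and [C] have coprime orders, every cyclic subgroup of [T x C] is the
   product of one of [T] and one of [C], so the count is multiplicative. A cyclic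
   group of order m contributes the number of divisors of m. Every element of the
   dicyclic group outside [<alpha>] squares to [alpha ^+ n], hence has order 4;
   these 2n elements thus generate n cyclic subgroups with two generators each.
   So the count is (size (divisors (2 * q ^ 2)) + q ^ 2) * 2 = (6 + q ^ 2) * 2. *)
Require Import Defs.
From mathcomp Require Import all_boot all_order all_algebra all_fingroup all_solvable.
From mathcomp Require Import zify.

Set Implicit Arguments.
Unset Strict Implicit.
Unset Printing Implicit Defensive.

(** * Divisor counts *)

Lemma size_divisors_pfactor p k : prime p -> size (divisors (p ^ k)) = k.+1.
Proof.
move=> p_pr; rewrite -[RHS](size_iota 0) -[RHS](size_map (expn p)).
apply: perm_size; apply: uniq_perm => [||d]; first exact: divisors_uniq.
  by rewrite map_inj_uniq ?iota_uniq //; apply/expnI/prime_gt1.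
rewrite -dvdn_divisors ?expn_gt0 ?prime_gt0 //.
apply/(dvdn_pfactor _ _ p_pr)/mapP => -[i lei ->]; exists i => //.
  by rewrite mem_iota ltnS.
by rewrite mem_iota ltnS in lei.
Qed.

(** Multiplication of a divisor of [m] by one of [n] is a bijection onto the divisors of [m * n],
    with inverse [d] to [(gcdn d m, gcdn d n)]. *)
Lemma size_divisorsM m n : 0 < m -> 0 < n -> coprime m n ->
  size (divisors (m * n)) = (size (divisors m) * size (divisors n))%N.
Proof.
move=> m_gt0 n_gt0 co_mn.
rewrite -(size_allpairs muln); apply: perm_size; apply: uniq_perm => [||d].
- exact: divisors_uniq.
- apply: allpairs_uniq; try exact: divisors_uniq.
  have gcdE d e : d %| m -> e %| n -> gcdn (d * e) m = d /\ gcdn (d * e) n = e.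
    move=> /[dup] d_m /(coprime_dvdl)/(_ co_mn) co_d.
    move=> /[dup] e_n /(coprime_dvdr)/(_ co_mn) co_e.
    split; first by rewrite gcdnC Gauss_gcdl //; apply/gcdn_idPr.
    by rewrite gcdnC Gauss_gcdr 1?coprime_sym //; apply/gcdn_idPr.
  move=> u v /allpairsP[[d e] /= [+ + ->]] /allpairsP[[d' e'] /= [+ + ->]] /=.
  rewrite -!dvdn_divisors // => d_m e_n d'_m e'_n eq_de.
  have [Ed Ee] := gcdE d e d_m e_n; have [Ed' Ee'] := gcdE d' e' d'_m e'_n.
  by congr pair; [rewrite -Ed eq_de | rewrite -Ee eq_de].
rewrite -dvdn_divisors ?muln_gt0 ?m_gt0 //; apply/idP/allpairsP => [d_mn|].
  have d_gt0 : 0 < d by apply: dvdn_gt0 d_mn; rewrite muln_gt0 m_gt0.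
  exists (gcdn d m, gcdn d n) => /=.
  rewrite -!dvdn_divisors // !dvdn_gcdr; split=> //.
  apply/eqP; rewrite eqn_dvd; apply/andP; split.
    by rewrite muln_gcdl !muln_gcdr !dvdn_gcd dvdn_mulr // dvdn_mulr // dvdn_mull.
  rewrite Gauss_dvd ?dvdn_gcdl //.
  exact: coprime_dvdl (dvdn_gcdr d m) (coprime_dvdr (dvdn_gcdr d n) co_mn).
by case=> -[a b] /= []; rewrite -!dvdn_divisors // => ? ? ->; rewrite dvdn_mul.
Qed.

Local Open Scope group_scope.

(** * Cyclic subgroups of cyclic groups and of coprime products *)

(** A subgroup of a cyclic group is determined by its order, and every divisor of the group order
    occurs as such an order. *)
Lemma card_cyclic_subgroups_cyclic (gT : finGroupType) (G : {group gT}) :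
  cyclic G -> #|cyclic_subgroups G| = size (divisors #|G|).
Proof.
move=> cycG; rewrite cardE -(size_map (fun H : {group gT} => #|H|)).
apply: perm_size; apply: uniq_perm => [||d]; last 1 first.
- rewrite -dvdn_divisors ?cardG_gt0 //.
  apply/mapP/idP => [[H + ->]|].
    by rewrite mem_enum inE => /andP[sHG _]; apply: cardSg.
  case/cyclicP: cycG => a defG; rewrite defG => /cycle_sub_group/setP.
  move/(_ <[a ^+ (#[a] %/ d)]>%G); rewrite set11 inE => /andP[sHa /eqP oH].
  by exists <[a ^+ (#[a] %/ d)]>%G; rewrite ?oH // mem_enum inE defG sHa cycle_cyclic.
- rewrite map_inj_in_uniq ?enum_uniq // => H K.
  rewrite !mem_enum !inE => /andP[sHG _] /andP[sKG _] /eqP.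
  by rewrite -(eq_subG_cyclic cycG) // => /eqP/val_inj.
- exact: divisors_uniq.
Qed.

(** One inclusion is clear; the orders agree because [(x, 1)] and [(1, y)] commute and have coprime
    orders. *)
Lemma cycle_setX (gT hT : finGroupType) (x : gT) (y : hT) :
  coprime #[x] #[y] -> <[(x, y)]> = setX <[x]> <[y]>.
Proof.
move=> co_xy; apply/eqP; rewrite eqEcard cycle_subG inE !cycle_id /= cardsX.
have -> : (x, y) = (x, 1) * (1, y) :> gT * hT by congr pair; rewrite ?mulg1 ?mul1g.
have ox : #[(x, 1 : hT)] = #[x] by exact: (order_injm (injm_pairg1 _ hT)) (in_setT x).
have oy : #[(1 : gT, y)] = #[y] by exact: (order_injm (injm_pair1g gT _)) (in_setT y).
rewrite -[#|<[_ * _]>|]/(#[_]) orderM ?ox ?oy //.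
by rewrite /commute; congr pair; rewrite ?mulg1 ?mul1g.
Qed.

Lemma card_cyclic_subgroupsX (gT hT : finGroupType)
    (G : {group gT}) (H : {group hT}) : coprime #|G| #|H| ->
  #|cyclic_subgroups (setX_group G H)|
    = (#|cyclic_subgroups G| * #|cyclic_subgroups H|)%N.
Proof.
move=> co_GH; rewrite -cardsX.
pose f (K : {group gT} * {group hT}) := setX_group K.1 K.2.
have f_inj : injective f.
  move=> [A B] [A' B'] /(congr1 val) /= /setP eqf.
  (* Each factor is recovered from the product as its slice at 1 in the other coordinate. *)
  congr pair; apply/group_inj/setP => z.
    by have:= eqf (z, 1); rewrite !inE !group1 !andbT.
  by have:= eqf (1, z); rewrite !inE !group1.
have co_sub x y : x \in G -> y \in H -> coprime #[x] #[y].
  move=> Gx Hy; apply: coprime_dvdl (order_dvdG Gx) _.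
  exact: coprime_dvdr (order_dvdG Hy) co_GH.
rewrite -(card_imset _ f_inj); congr #|pred_of_set _|; apply/setP => K.
rewrite inE; apply/andP/imsetP => [[sK /cyclicP[[x y] defK]] | [[A B]]].
  have [Gx Hy] : x \in G /\ y \in H.
    by move: sK; rewrite defK cycle_subG inE => /andP.
  exists (<[x]>%G, <[y]>%G); first by rewrite !inE /= !cycle_subG Gx Hy !cycle_cyclic.
  by apply/group_inj; rewrite /= defK cycle_setX // co_sub.
rewrite !inE /= => /andP[/andP[sAG /cyclicP[x defA]] /andP[sBH /cyclicP[y defB]]] -> /=.
move: sAG sBH; rewrite defA defB !cycle_subG => Gx Hy.
by rewrite -cycle_setX ?co_sub // cycle_subG inE Gx Hy cycle_cyclic.
Qed.

(** * A permutation model of the dicyclic group *)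

(* [dic_alpha] and [dic_beta] are the right translations by alpha and beta on
   {alpha^x beta^b}, with alpha^x identified with x : A (through alpha -> s,
   beta^2 -> z) and powers of alpha collected on the left. Such a model is needed to
   show that the presented group has order at least 4n. *)
Section DicyclicModel.

Import GRing.Theory.
Local Open Scope ring_scope.

Variables (A : finZmodType) (s z : A).
Hypothesis zz0 : z + z = 0.

Definition dic_alpha_fun (u : A * bool) : A * bool :=
  (if u.2 then u.1 - s else u.1 + s, u.2).

Definition dic_beta_fun (u : A * bool) : A * bool :=
  if u.2 then (u.1 + z, false) else (u.1, true).

Lemma dic_alpha_inj : injective dic_alpha_fun.
Proof.
by case=> x [] [y []]; rewrite /dic_alpha_fun //= => -[] /addIr ->.
Qed.

Lemma dic_beta_inj : injective dic_beta_fun.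
Proof.
by case=> x [] [y []]; rewrite /dic_beta_fun //= => -[]; try move/addIr; move->.
Qed.

Definition dic_alpha := perm dic_alpha_inj.
Definition dic_beta := perm dic_beta_inj.

Lemma dic_alphaX k u :
  (dic_alpha ^+ k)%g u = (if u.2 then u.1 - s *+ k else u.1 + s *+ k, u.2).
Proof.
elim: k => [|k IHk]; first by rewrite perm1 mulr0n subr0 addr0; case: u => x [].
rewrite expgSr permM IHk permE /dic_alpha_fun /= mulrSr opprD !addrA.
by case: u.2.
Qed.

Lemma dic_alpha_beta :
  (dic_beta * dic_alpha * dic_beta^-1 = dic_alpha^-1)%g.
Proof.
(* Clearing inverses leaves alpha beta alpha = beta, which is checked pointwise. *)
apply: (mulIg dic_beta); rewrite mulgKV; apply: (mulgI dic_alpha).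
rewrite mulKVg; apply/permP => -[x b].
by rewrite !permM !permE; rewrite /dic_alpha_fun /dic_beta_fun; case: b;
  rewrite /= ?addrK // addrAC subrK.
Qed.

Lemma dic_betaX2 n : s *+ n = z -> (dic_alpha ^+ n = dic_beta ^+ 2)%g.
Proof.
move=> sn; apply/permP => -[x b].
rewrite dic_alphaX expgS expg1 permM !permE /dic_beta_fun /= sn.
(* When [b] is true the claim is [x - z = x + z], which is where [zz0] enters. *)
by case: b; rewrite //= -{1}[x]addr0 -zz0 addrA addrK.
Qed.

End DicyclicModel.

Lemma dicyclic_model n : 0 < n ->
  exists (rT : finGroupType) (G : {group rT}),
    G \homg Grp (alpha : beta : alpha ^+ (2 * n)%N = 1, alpha ^+ n = beta ^+ 2,
      beta * alpha * beta^-1 = alpha^-1) /\ (4 * n <= #|G|)%N.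
Proof.
move=> n_gt0; pose m := (2 * n)%N.
have m_gt1 : (1 < m)%N by apply: (leq_mul (leqnn 2) n_gt0).
have m0 : (m%:R = 0 :> 'Z_m)%R by apply: pchar_Zp.
have nn0 : (n%:R + n%:R = 0 :> 'Z_m)%R by rewrite -GRing.natrD addnn -mul2n.
pose a := dic_alpha (1%R : 'Z_m); pose b := dic_beta (n%:R%R : 'Z_m).
exists _, (<[a]> <*> <[b]>)%G; split.
  apply/existsP; exists (a, b); rewrite /= !xpair_eqE eqxx /= dic_alpha_beta.
  rewrite (dic_betaX2 nn0 (erefl _ : (1 *+ n = n%:R)%R)) !eqxx !andbT.
  apply/eqP/permP => u.
  by rewrite dic_alphaX perm1 m0 GRing.subr0 GRing.addr0; case: u => x [].
have sAG : <[a]> \subset <[a]> <*> <[b]> by apply: joing_subl.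
rewrite -(Lagrange sAG) -[4%N]/(2 * 2)%N mulnAC leq_mul //.
  (* The k-th power of [a] sends [(0, false)] to [(k, false)], so [m] divides the order of [a]. *)
  apply: dvdn_leq => //; have /permP := expg_order a.
  move/(_ (0%R, false)).
  rewrite dic_alphaX perm1 /= GRing.add0r => -[].
  by move/(congr1 val); rewrite /= val_Zp_nat // => /eqP.
(* Powers of [a] preserve the boolean component, while [b] flips it. *)
rewrite indexg_gt1 join_subG subxx /= cycle_subG.
apply/negP => /cycleP[k /permP/(_ (0%R, false))].
by rewrite dic_alphaX permE.
Qed.

(** * Structure of the dicyclic group and its cyclic subgroups *)

(** The relations force [#[x] <= 2 * n] and [#|T| <= 2 * #[x]]; the model gives [4 * n <= #|T|], so
    equality holds throughout. *)
Lemma dicyclic_structure n (gT : finGroupType) (T : {group gT}) :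
    0 < n -> dicyclic T n ->
  exists x y, [/\ x \in T, #[x] = (2 * n)%N & #|T : <[x]>| = 2]
    /\ [/\ y \in T :\: <[x]>, y ^+ 2 = x ^+ n & x ^ y = x^-1].
Proof.
move=> n_gt0 dicT; have [rT [G [homG leG]]] := dicyclic_model n_gt0.
(* By [dicT] the images of [T] are exactly the groups satisfying the presentation: applied to [G]
   this bounds [#|T|] below, applied to [T] it yields generators. *)
have: T \homg T by apply: homg_refl.
move: homG; rewrite -!dicT => /leq_homg leGT; rewrite dicT.
case/existsP=> -[x y] /= /eqP[defT x2n xn yx].
have xy : x ^ y = x^-1.
  by rewrite -[x in LHS]invgK conjVg -yx conjgE !mulgA mulVg mul1g mulgKV.
have nxy : <[y]> \subset 'N(<[x]>) by rewrite norms_cycle xy groupV cycle_id.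
have sXT : <[x]> \subset T by rewrite -defT joing_subl.
have Tx : x \in T by rewrite -cycle_subG.
have Ty : y \in T by rewrite -cycle_subG -defT joing_subr.
have ox_le : #[x] <= 2 * n.
  by apply: dvdn_leq; rewrite ?muln_gt0 // order_dvdn x2n.
have leT : (#|T| <= 2 * #[x])%N.
  have sT : T \subset <[x]> :|: <[x]> :* y.
    rewrite -defT norm_joinEr //; apply/subsetP=> _ /mulsgP[u _ Xu /cycleP[j ->] ->].
    (* Since [y ^+ 2] is a power of [x], only the parity of [j] matters modulo [<[x]>]. *)
    rewrite -(odd_double_half j) addnC expgD -mul2n expgM -xn mulgA.
    have Xv : u * x ^+ n ^+ j./2 \in <[x]> by rewrite groupM // !groupX ?cycle_id.
    by rewrite inE; case: (odd j); rewrite ?mulg1 ?Xv // mem_rcoset mulgK Xv orbT.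
  apply: leq_trans (subset_leq_card sT) _; apply: leq_trans (leq_card_setU _ _) _.
  by rewrite card_rcoset mul2n -addnn.
have ox : #[x] = (2 * n)%N.
  apply/eqP; rewrite eqn_leq ox_le -(leq_pmul2l (isT : (0 < 2)%N)).
  by rewrite mulnA (leq_trans (leq_trans leG leGT)).
have iT : #|T : <[x]>| = 2.
  apply/eqP; rewrite -(eqn_pmul2l (cardG_gt0 <[x]>)) Lagrange // mulnC eqn_leq leT.
  by rewrite -[#|<[x]>|]/#[x] ox mulnA (leq_trans leG).
exists x, y; split; split=> //; rewrite inE Ty andbT; apply/negP => Xy.
have : T \subset <[x]> by rewrite -defT join_subG subxx cycle_subG.
by rewrite -indexg_eq1 iT.
Qed.

Lemma card_cyclic_subgroups_dicyclic n (gT : finGroupType) (T : {group gT}) :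
  0 < n -> dicyclic T n ->
  #|T| = (4 * n)%N
  /\ #|cyclic_subgroups T| = (size (divisors (2 * n)) + n)%N.
Proof.
move=> n_gt0 /(dicyclic_structure n_gt0)[x [y [[Tx ox iT] [Ty y2 xy]]]].
have sXT : <[x]> \subset T by rewrite cycle_subG.
have oT : #|T| = (4 * n)%N.
  by rewrite -(Lagrange sXT) iT -[#|_|]/#[x] ox mulnAC.
split=> //.
have ord4 u : u \in T :\: <[x]> -> #[u] = 4.
  rewrite -(rcoset_index2 sXT iT Ty) => /rcosetP[_ /cycleP[k ->] ->].
  have u2 : (x ^+ k * y) ^+ 2 = x ^+ n.
    by rewrite expgS expg1 {1}(conjgC (x ^+ k)) conjXg xy expgVn mulgA mulgKV -y2.
  (* The square of [u] has order 2, and the prime exponent 2 divides that order, so [u] has order 2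
     * 2. *)
  apply: (@orderXprime _ 2 2) => //; rewrite u2 orderXdiv ox ?dvdn_mull //.
  by rewrite mulnK.
have sub_cyc : cyclic_subgroups <[x]> \subset cyclic_subgroups T.
  by apply/subsetP=> H; rewrite !inE => /andP[/subset_trans-> //].
rewrite -(cardsID (cyclic_subgroups <[x]>)) (setIidPr sub_cyc).
rewrite card_cyclic_subgroups_cyclic ?cycle_cyclic // -[#|<[x]>|]/#[x] ox.
congr (_ + _)%N; set D := _ :\: _.
have DP H : (H \in D) = [exists u in T :\: <[x]>, H == <[u]>%G].
  rewrite !inE; apply/idP/exists_inP => [/and3P[nH sHT cycH]|[u + /eqP->]].
    case/cyclicP: cycH => u defH; exists u; last by apply/eqP/group_inj.
    move: sHT nH; rewrite defH cycle_subG inE cycle_cyclic cycle_subG andbT => ->.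
    by rewrite andbT.
  by rewrite inE /= !cycle_subG cycle_cyclic !andbT.
have: #|T :\: <[x]>| = (2 * n)%N.
  by rewrite cardsD (setIidPr sXT) -[#|<[x]>|]/#[x] oT ox -mulnBl.
(* Double counting: the elements outside [<[x]>] are grouped by the subgroup they generate, and each
   fibre has [totient 4] = 2 elements. *)
rewrite -sum1_card (partition_big (fun u => <[u]>%G) (mem D)) => [|u Xu]; last first.
  by rewrite /= DP; apply/exists_inP; exists u.
rewrite (eq_bigr (fun=> 2)) => [|H /=]; last first.
  rewrite DP => /exists_inP[u Xu /eqP->].
  rewrite sum1_card -[RHS]/(totient 4) -(ord4 u Xu) totient_gen.
  apply: eq_card => v; rewrite inE unfold_in /= -val_eqE /= /generator eq_sym.
  (* Every generator of [<[u]>] also lies outside [<[x]>], so the fibre is the full set of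
     generators. *)
  have [eq_uv|_] := eqP; rewrite ?andbF //= andbT.
  by move: Xu; rewrite !inE -!cycle_subG eq_uv.
by rewrite sum_nat_const mulnC => /eqP; rewrite eqn_pmul2l // => /eqP.
Qed.

Theorem proposition5p2 (p q n : nat) (p_prime : prime p) (q_prime : prime q)
    (p_odd : odd p) (lt_pq : p < q) (n_def : n = (q ^ 2)%N)
    (gT cT : finGroupType) (T : {group gT}) (C : {group cT})
    (T_dicyclic : dicyclic T n) (C_cyclic : cyclic C) (C_card : #|C| = p)
    (t : int)
    (t_def : (#|cyclic_subgroups (setX_group T C)|%:Z
                = #|setX_group T C|%:Z - t)%R) :
  (t = 2 * q%:Z ^+ 2 * (2 * p%:Z - 1) - 12)%R /\
  (#|cyclic_subgroups (setX_group T C)|%:Z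
     = 4 * q%:Z ^+ 2 * p%:Z - (2 * q%:Z ^+ 2 * (2 * p%:Z - 1) - 12))%R.
Proof.
have q_gt0 := prime_gt0 q_prime; have p_gt2 := odd_prime_gt2 p_odd p_prime.
have n_gt0 : 0 < n by rewrite n_def expn_gt0 q_gt0.
have [oT cT_T] := card_cyclic_subgroups_dicyclic n_gt0 T_dicyclic.
have co_TC : coprime #|T| #|C|.
  rewrite oT C_card n_def coprimeMl -[4%N]/(2 ^ 2)%N !coprimeXl ?coprime2n //.
  by rewrite coprime_sym prime_coprime // dvdn_prime2 // ltn_eqF.
have co_2n : coprime 2 n.
  (* Here [q] is odd because 2 < [p] < [q]. *)
  rewrite n_def coprime2n oddX /=; case: (even_prime q_prime) => // q2.
  by rewrite q2 ltnNge ltnW in lt_pq.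
have cardE : #|cyclic_subgroups (setX_group T C)| = (2 * q ^ 2 + 12)%N.
  rewrite card_cyclic_subgroupsX // cT_T card_cyclic_subgroups_cyclic // C_card.
  (* Writing 2 and [p] as first powers makes every divisor count one of a prime power. *)
  rewrite size_divisorsM // n_def -[p]expn1 -[in divisors 2](expn1 2).
  rewrite !size_divisors_pfactor //.
  by rewrite mulnDl addnC mulnC.
rewrite cardE; move: t_def; rewrite cardE cardsX oT C_card n_def.
(* With the squares expanded, what remains is linear in the monomials q * q and q * q * p. *)
rewrite GRing.expr2 -mulnn; lia.
Qed.
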